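(* Let $R$ be a range set. If $(X,d)$ is the $R$-Urysohn universal ultrametric space, then so is $(X\times X, d\times_\infty d)$. In particular, $(X\times X,d\times_\infty d)$ is isometric to $(X,d)$.
   Context: The $\ell^\infty$-product metric is $(d\times_\infty e)((x,y),(u,v))=\max\{d(x,u),e(y,v)\}$. A range set is a subset $R\subseteq[0,\infty)$ with $0\in R$. An ultrametric space $(X,d)$ (i.e. $d(x,y)\le\max\{d(x,z),d(z,y)\}$) is $R$-valued if $d(x,y)\in R$ for all $x,y\in X$. $\mathscr{N}(R)=\mathscr{N}(R,\omega_0)$ is the class of all finite $R$-valued ultrametric spaces. For a class $\mathscr{C}$ of metric spaces, $(X,d)$ is $\mathscr{C}$-injective if it is non-empty and for all $(Y,e),(Z,h)\in\mathscr{C}$ and all isometric (distance-preserving) embeddings $\phi\colon Y\to Z$, $f\colon Y\to X$ there is an isometric embedding $F\colon Z\to X$ with $F\circ\phi=f$. If $R$ is finite or countable, the $R$-Urysohn universal ultrametric space is the separable complete $\mathscr{N}(R)$-injective $R$-valued ultrametric space (known to exist and be unique up to isometry). If $R$ is uncountable, the $R$-Urysohn universal ultrametric space is the $R$-petaloid ultrametric space (known to exist and be unique up to isometry), defined as follows. A subset $E\subseteq[0,\infty)$ is semi-sporadic if $E=\{0\}\cup\{a_i\mid i\ge0\}$ for some strictly decreasing sequence $(a_i)_{i\ge 0}$ in $(0,\infty)$ with $a_i\to0$; it is tenuous if it is finite or semi-sporadic. $\mathbf{TEN}(R)$ is the set of all tenuous range sets contained in $R$. For $A\subseteq X$, $d(x,A)=\inf_{a\in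 A}d(x,a)$. For uncountable $R$, a metric space $(X,d)$ is $R$-petaloid if it is an $R$-valued ultrametric space and there is a family $\{\Pi(X,S)\}_{S\in\mathbf{TEN}(R)}$ of subspaces of $X$ (an $R$-petal of $X$) such that: (P1) if $S\in\mathbf{TEN}(R)$ and $S\ne\{0\}$, then $(\Pi(X,S),d)$ is the $S$-Urysohn universal ultrametric space, i.e. a separable complete $\mathscr{N}(S)$-injective $S$-valued ultrametric space; (P2) $\bigcup_{S\in\mathbf{TEN}(R)}\Pi(X,S)=X$; (P3) $\Pi(X,S)\cap\Pi(X,T)=\Pi(X,S\cap T)$ for all $S,T\in\mathbf{TEN}(R)$; (P4) if $S,T\in\mathbf{TEN}(R)$ and $x\in\Pi(X,T)$, then $d(x,\Pi(X,S))\in\{0\}\cup(T\setminus S)$. *)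

(* Defs.v *)
From HB Require Import structures.
From mathcomp Require Import all_boot all_order all_algebra.
From mathcomp Require Import all_classical all_reals all_analysis.

Set Implicit Arguments.
Unset Strict Implicit.
Unset Printing Implicit Defensive.

Import Order.TTheory GRing.Theory Num.Theory.
Import numFieldNormedType.Exports.

Local Open Scope classical_set_scope.
Local Open Scope ring_scope.

(* The library already equips X * Y with the pseudometric structure whose balls
   are products of balls; the l^oo-product metric is a distance for it. *)
Section prod_metric.
Context {K : realType} {X Y : metricType K}.
Implicit Types p q : (X * Y)%type.

Definition prod_mdist p q : K :=
  Num.max (mdist p.1 q.1) (mdist p.2 q.2).

Let prod_mdist_ge0 p q : 0 <= prod_mdist p q.
Proof. by rewrite /prod_mdist le_max mdist_ge0. Qed.

Let prod_mdist_positivity p q : prod_mdist p q = 0 -> p = q.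
Proof.
move=> pq0; rewrite [p]surjective_pairing [q]surjective_pairing.
have h1 : mdist p.1 q.1 <= 0 by rewrite -pq0 /prod_mdist le_max lexx.
have h2 : mdist p.2 q.2 <= 0 by rewrite -pq0 /prod_mdist le_max lexx orbT.
by congr (_, _); apply: mdist_positivity; apply/eqP;
  rewrite eq_le mdist_ge0 andbT.
Qed.

Let prod_ballEmdist p (e : K) : ball p e = [set q | prod_mdist p q < e].
Proof.
rewrite predeqE => q; rewrite /prod_mdist /= gt_max.
change (ball p e q) with (ball p.1 e q.1 /\ ball p.2 e q.2).
by rewrite !ballEmdist; split=> [[/= -> ->]//|/andP[]].
Qed.

HB.instance Definition _ := PseudoMetric_isMetric.Build K (X * Y)%type
  prod_mdist_ge0 prod_mdist_positivity prod_ballEmdist.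

End prod_metric.

(* A subset A of X, seen as a type, with the restricted metric. *)
Section subspace_metric.
Context {K : realType} {X : metricType K} (A : set X).
Implicit Types x y : set_type A.

Definition sub_mdist x y : K := mdist (set_val x) (set_val y).

Let sub_mdist_ge0 x y : 0 <= sub_mdist x y.
Proof. exact: mdist_ge0. Qed.

Let sub_mdist_positivity x y : sub_mdist x y = 0 -> x = y.
Proof. by move=> /mdist_positivity/val_inj. Qed.

Let sub_ballEmdist x (e : K) : ball x e = [set y | sub_mdist x y < e].
Proof.
rewrite predeqE => y.
change (ball x e y) with (ball (set_val x) e (set_val y)).
by rewrite ballEmdist.
Qed.

HB.instance Definition _ := PseudoMetric_isMetric.Build K (set_type A)
  sub_mdist_ge0 sub_mdist_positivity sub_ballEmdist.

End subspace_metric.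

Section urysohn.
Context {K : realType}.
Implicit Types (R S T E : set K) (X Y Z : metricType K).

Definition isometric_embedding X Y (f : X -> Y) : Prop :=
  forall x y, mdist (f x) (f y) = mdist x y.

Definition isometric X Y : Prop :=
  exists2 f : X -> Y, isometric_embedding f & bijective f.

Definition range_set R : Prop := R `<=` [set r | 0 <= r] /\ R 0.

Definition ultrametric X : Prop :=
  forall x y z : X, mdist x y <= Num.max (mdist x z) (mdist z y).

Definition valued_in R X : Prop := forall x y : X, R (mdist x y).

Definition finite_valued_ultrametric R X : Prop :=
  [/\ finite_set [set: X], ultrametric X & valued_in R X].

Definition injective_for (C : metricType K -> Prop) X : Prop :=
  [set: X] !=set0 /\
  forall Y Z, C Y -> C Z ->
  forall (phi : Y -> Z) (f : Y -> X),
    isometric_embedding phi -> isometric_embedding f ->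
    exists2 F : Z -> X, isometric_embedding F & F \o phi = f.

Definition separable X : Prop :=
  exists2 D : set X, countable D & dense D.

(* The axiom of the library's completeType, without its distinguished point. *)
Definition complete_space X : Prop :=
  forall F : set_system X, ProperFilter F -> cauchy F ->
    exists x : X, F --> x.

Definition separable_urysohn R X : Prop :=
  [/\ ultrametric X, valued_in R X, separable X, complete_space X &
      injective_for (finite_valued_ultrametric R) X].

Definition semi_sporadic E : Prop :=
  exists a : nat -> K,
    [/\ forall i, 0 < a i,
        forall i j, (i < j)%N -> a j < a i,
        a i @[i --> \oo] --> (0 : K) &
        E = [set 0] `|` range a].

Definition tenuous E : Prop := finite_set E \/ semi_sporadic E.

Definition TEN R : set (set K) :=
  [set S | [/\ range_set S, tenuous S & S `<=` R]].

(* d(x, A), in the extended reals so that d(x, set0) = +oo (the real-valued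
   infimum of the empty set would be 0). *)
Definition dist_to_set X (x : X) (A : set X) : \bar K :=
  ereal_inf [set (mdist x a)%:E | a in A].

(* Only the values of P on TEN R matter. *)
Definition is_petal R X (P : set K -> set X) : Prop :=
  [/\ forall S, TEN R S -> S <> [set 0] ->
        separable_urysohn S (set_type (P S) : metricType K),
      \bigcup_(S in TEN R) P S = [set: X],
      forall S T, TEN R S -> TEN R T -> P S `&` P T = P (S `&` T) &
      forall S T (x : X), TEN R S -> TEN R T -> P T x ->
        exists2 r : K, ([set 0] `|` (T `\` S)) r & dist_to_set x (P S) = r%:E].

Definition petaloid R X : Prop :=
  [/\ ultrametric X, valued_in R X & exists P : set K -> set X, is_petal R P].

Definition urysohn R X : Prop :=
  (countable R -> separable_urysohn R X) /\ (~ countable R -> petaloid R X).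

End urysohn.

(* Main.v *)
(** Give every point [x] a coordinate function sending [r > 0] in [R] to a
    label of the open [r]-ball of [x] inside its closed [r]-ball, the labels
    of the open balls in a closed ball being exactly the natural numbers. If the
    label [0] is chosen well, the points of a Urysohn space correspond exactly
    to the functions [f] such that [{0} \cup supp f] is a tenuous subset of
    [R], and [d(x, y)] is the largest [r] where the coordinates of [x] and [y]
    differ. In the separable case label [0] goes to the open ball hit first by a
    dense sequence; in the petaloid case it goes to the unique open ball
    meeting a petal [Pi(X, S)] with [r] not in [S]. This model is visibly
    isometric to its own square, through a bijection of [nat * nat] with [nat]
    fixing [0], and being a Urysohn space is invariant under isometry. *)
Require Import Defs.
From HB Require Import structures.
From mathcomp Require Import all_boot all_order all_algebra.
From mathcomp Require Import all_classical all_reals all_analysis.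

Set Implicit Arguments.
Unset Strict Implicit.
Unset Printing Implicit Defensive.

Import Order.TTheory GRing.Theory Num.Theory.
Import numFieldNormedType.Exports.

Local Open Scope classical_set_scope.
Local Open Scope ring_scope.

(** * Sequences, density and distance to a subset *)

Section metric_basics.
Context {K : realType}.
Implicit Types (X Y : metricType K).

Lemma ultrametric_le X (um : ultrametric X) (x y z : X) (r : K) :
  mdist x z <= r -> mdist z y <= r -> mdist x y <= r.
Proof. by move=> xz zy; rewrite (le_trans (um x y z))// ge_max xz zy. Qed.

Lemma ultrametric_lt X (um : ultrametric X) (x y z : X) (r : K) :
  mdist x z < r -> mdist z y < r -> mdist x y < r.
Proof. by move=> xz zy; rewrite (le_lt_trans (um x y z))// gt_max xz zy. Qed.

Lemma separableP X : separable X <->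
  exists2 D : set X, countable D &
    forall x e, 0 < e -> exists2 y, D y & mdist x y < e.
Proof.
split=> -[D cD dD]; exists D => //.
  move=> x e e0; have [||y [xy Dy]] := dD (ball x e)°.
  - by exists x; apply: nbhsx_ballx.
  - exact: open_interior.
  - by exists y => //; move/interior_subset: xy; rewrite ballEmdist.
move=> O [x Ox] oO.
have /nbhs_ballP[e /= e0 xeO] := open_nbhs_nbhs (conj oO Ox).
have [y Dy xy] := dD x e e0; exists y; split=> //.
by apply: xeO; rewrite ballEmdist.
Qed.

Definition cauchy_seq X (u : nat -> X) : Prop :=
  forall e, 0 < e -> exists N, forall n m, (N <= n)%N -> (N <= m)%N ->
    mdist (u n) (u m) < e.

Definition seq_limit X (u : nat -> X) (l : X) : Prop :=
  forall e, 0 < e -> exists N, forall n, (N <= n)%N -> mdist l (u n) < e.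

Lemma cauchy_seq_cvg X (cX : complete_space X) (u : nat -> X) :
  cauchy_seq u -> exists l, seq_limit u l.
Proof.
move=> cu; have [|l ul] := cX (u @ \oo).
  apply/cauchy_ballP => e e0; have [N uN] := cu _ e0.
  exists ([set u n | n in [set n | (N <= n)%N]],
          [set u n | n in [set n | (N <= n)%N]]) => /=.
    by split; exists N => // n /= Nn; exists n.
  by move=> [x y] /= [[n Nn <-] [m Nm <-]]; rewrite ballEmdist; apply: uN.
exists l => e e0.
have [N _ uN] := metricType_numDomainType.cvgr_dist_lt ul e0.
by exists N => n Nn; apply: uN.
Qed.

Lemma invn_small (e : K) : 0 < e -> exists N : nat, forall n, (N <= n)%N ->
  n.+1%:R^-1 < e.
Proof.
move=> e0; have [N _ hN] := near_infty_natSinv_lt (PosNum e0).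
by exists N => n Nn; apply: (hN n) => /=.
Qed.

Lemma dense_seq X : separable X -> [set: X] !=set0 ->
  exists u : nat -> X, forall x e, 0 < e -> exists i, mdist x (u i) < e.
Proof.
move=> /separableP[D cD dD] [x0 _].
have [y0 Dy0 _] := dD x0 1 ltr01.
case/pfcard_geP: cD => [D0|[f]]; first by move: Dy0; rewrite D0.
exists f => x e e0; have [y Dy xy] := dD x e e0.
by have [i _ fi] := @surj _ _ _ _ f y Dy; exists i; rewrite fi.
Qed.

Lemma complete_subspace_cvg X (A : set X) (u : nat -> X) :
  complete_space (set_type A : metricType K) -> (forall n, A (u n)) ->
  cauchy_seq u -> exists2 l, A l & seq_limit u l.
Proof.
move=> cA uA cu.
have [l lu] := @cauchy_seq_cvg _ cA (fun n => SigSub (mem_set (uA n))) cu.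
by exists (set_val l); first exact: set_valP.
Qed.

Lemma dist_to_set_lt X (x : X) (A : set X) (e r : K) :
  dist_to_set x A = e%:E -> e < r -> exists2 p, A p & mdist x p < r.
Proof.
move=> xA er; have : (dist_to_set x A < r%:E)%E by rewrite xA lte_fin.
by move=> /ereal_inf_lt[_ [p Ap <-]]; rewrite lte_fin; exists p.
Qed.

Lemma dist_to_set_le X (x p : X) (A : set X) (e : K) :
  dist_to_set x A = e%:E -> A p -> e <= mdist x p.
Proof.
by move=> xA Ap; rewrite -lee_fin -xA; apply: ereal_inf_lbound; exists p.
Qed.

(** Points of [A] at distance below [1/(n+1)] from [x] form a Cauchy sequence by the ultrametric
    inequality; its limit in [A] can only be [x]. *)
Lemma complete_subspace_closed X (um : ultrametric X) (x : X) (A : set X) :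
  complete_space (set_type A : metricType K) -> dist_to_set x A = 0%:E -> A x.
Proof.
move=> cA xA.
have /choice[u uP] : forall n : nat, exists p, A p /\ mdist x p < n.+1%:R^-1.
  move=> n; have [|p Ap xp] := dist_to_set_lt (r := n.+1%:R^-1) xA.
    by rewrite invr_gt0.
  by exists p.
have ux e : 0 < e -> exists N, forall n, (N <= n)%N -> mdist x (u n) < e.
  move=> e0; have [N hN] := invn_small e0; exists N => n Nn.
  exact: lt_trans (proj2 (uP n)) (hN n Nn).
have [||l Al lu] := @complete_subspace_cvg _ A u cA.
- by move=> n; case: (uP n).
- move=> e e0; have [N hN] := ux e e0; exists N => n m Nn Nm.
  by apply: (ultrametric_lt um _ (hN m Nm)); rewrite metric_sym hN.
suff -> : x = l by [].
apply: mdist_positivity; apply/eqP; rewrite eq_le mdist_ge0 andbT leNgt.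
apply/negP => xl; have [N hN] := ux _ xl; have [M hM] := lu _ xl.
have ul : mdist (u (maxn N M)) l < mdist x l.
  by rewrite metric_sym hM// leq_maxr.
by have := ultrametric_lt um (hN _ (leq_maxl N M)) ul; rewrite ltxx.
Qed.

End metric_basics.

(** * Tenuous sets as sets finite above every positive level *)

Section tenuous_sets.
Context {K : realType}.
Implicit Types (S E : set K).

Definition finite_above E : Prop :=
  forall e : K, 0 < e -> finite_set [set s | E s /\ e <= s].

Lemma finite_set_max E : finite_set E -> E !=set0 ->
  exists2 m, E m & forall s, E s -> s <= m.
Proof.
move=> /finite_seqP[s ->] {E}; elim: s => [|a s ih] [x]; first by [].
move=> _; case: s ih => [_|b s ih].
  by exists a => /=; rewrite ?mem_seq1// => y; rewrite mem_seq1 => /eqP ->.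
have [|m ms mM] := ih; first by exists b => /=; rewrite mem_head.
case: (leP a m) => am.
  exists m => /=; first by rewrite in_cons ms orbT.
  by move=> y /=; rewrite in_cons => /orP[/eqP ->//|]; exact: mM.
exists a => /=; first by rewrite mem_head.
move=> y /=; rewrite in_cons => /orP[/eqP ->//|/mM/le_trans]; apply.
exact: ltW.
Qed.

Lemma finite_set_min E : finite_set E -> E !=set0 ->
  exists2 m, E m & forall s, E s -> m <= s.
Proof.
move=> fE [x Ex]; have [||_ [m Em <-] mM] := @finite_set_max (-%R @` E).
- exact: finite_image.
- by exists (- x); exists x.
- by exists m => // s Es; rewrite -lerN2; apply: mM; exists s.
Qed.

(** An infinite [E] that is finite above every positive level is listed downwards: each term is the
    largest positive element of [E] below the previous one. *)
Lemma tenuousP E : range_set E -> tenuous E <-> finite_above E.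
Proof.
move=> [Ege E0]; split.
  move=> [fE e e0|[a [a0 adec acvg ->]] e e0].
    by apply: sub_finite_set fE => s [].
  have [N _ aN] := metricType_numDomainType.cvgr_dist_lt (V := K^o) acvg e0.
  apply: (@sub_finite_set _ _ [set a n | n in `I_N]); last first.
    exact/finite_image/finite_II.
  move=> s [[->|[n _ <-]]]; first by rewrite leNgt e0.
  move=> ean; exists n => //=; rewrite ltnNge; apply/negP => /aN /=.
  by rewrite /mdist/= subr0 gtr0_norm// ltNge ean.
move=> fE; have [finE|infE] := pselect (finite_set E); [by left|right].
have [T TE] : exists T, forall s, E s -> s < T.
  have [ne|em] := pselect ([set s | E s /\ 1 <= s] !=set0).
    have [m [_ m1] mM] := finite_set_max (fE _ ltr01) ne.
    exists (m + 1) => s Es; case: (leP 1 s) => s1.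
      by rewrite ltr_pwDr// mM.
    by rewrite (lt_le_trans s1)// lerDr (le_trans ler01 m1).
  exists 1 => s Es; rewrite ltNge; apply/negP => s1; apply: em.
  by exists s.
pose good t m := [/\ E m, 0 < m, m < t & forall s, E s -> s < t -> s <= m].
have goodE t : 0 < t -> exists m, good t m.
  move=> t0; have [[s [Es s0 st]]|no] :=
      pselect (exists s, [/\ E s, 0 < s & s < t]); last first.
    exfalso; apply: infE; apply: (@sub_finite_set _ _
        ([set 0] `|` [set s | E s /\ t <= s])); last first.
      by rewrite finite_setU; split; [exact: finite_set1|exact: fE].
    move=> s Es; have [ts|st] := leP t s; first by right.
    have := Ege _ Es; rewrite /= le_eqVlt => /orP[/eqP<-|s0]; first by left.
    by exfalso; apply: no; exists s.
  have [||m [[Em sm] mt] mM] :=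
      @finite_set_max ([set u | E u /\ s <= u] `&` [set u | u < t]).
  - by apply: sub_finite_set (fE _ s0) => u [].
  - by exists s; split.
  - exists m; split=> //; first exact: lt_le_trans sm.
    move=> u Eu ut; have [su|us] := leP s u; first exact: mM.
    by rewrite (le_trans (ltW us)).
have T0 : 0 < T by exact: TE.
pose next t := xget 0 [set m | good t m].
have nextP t : 0 < t -> good t (next t).
  by move=> t0; have [m gm] := goodE _ t0; exact: (xgetPex _ (ex_intro _ m gm)).
(* The extra iteration makes [a 0] the maximum of [E] instead of the strict bound [T], which lies
   outside [E]. *)
pose a n := iter n.+1 next T.
have aP n : 0 < a n.
  elim: n => [|n ih]; first by have [] := nextP _ T0.
  by have [] := nextP _ ih.
have agood n : good (a n) (a n.+1) by exact: nextP.
have aE n : E (a n).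
  case: n => [|n]; first by have [] := nextP _ T0.
  by have [] := agood n.
have adec i j : (i < j)%N -> a j < a i.
  elim: j => // j ih; rewrite ltnS leq_eqVlt => /orP[/eqP->|/ih].
    by have [] := agood j.
  by apply: lt_trans; have [] := agood j.
(* Otherwise the injective sequence [a] would map all of [nat] into a finite part of [E]. *)
have asmall e : 0 < e -> exists N, a N < e.
  move=> e0; apply: contrapT => no.
  have ae n : e <= a n by rewrite leNgt; apply/negP => an; apply: no; exists n.
  apply: infinite_nat.
  rewrite (_ : [set: nat] = a @^-1` [set s | E s /\ e <= s]); last first.
    by apply/seteqP; split=> n //= _; split.
  apply: finite_preimage (fE _ e0) => i j _ _ aij.
  by case: (ltngtP i j) => // /adec; rewrite aij ltxx.
exists a; split=> //.
  apply/(metricType_numDomainType.cvgrPdist_lt (V := K^o)) => e e0.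
  have [N aN] := asmall e e0; exists N => // n /= Nn.
  rewrite /mdist/= subr0 gtr0_norm// (le_lt_trans _ aN)//.
  by move: Nn; rewrite leq_eqVlt => /orP[/eqP->//|/adec/ltW].
apply/seteqP; split=> s.
  move=> Es; have := Ege _ Es; rewrite /= le_eqVlt => /orP[/eqP<-|s0].
    by left.
  (* The least [N] with [a N <= s] gives [a N = s]: no element of [E] lies strictly between
     consecutive terms, or between [a 0] and [T]. *)
  right; have exN : exists N, a N <= s.
    by have [N /ltW aN] := asmall s s0; exists N.
  case: (ex_minnP exN) => -[|n] an nmin; [exists 0%N|exists n.+1] => //;
    apply/eqP; rewrite eq_le an /=.
    by have [_ _ _] := nextP _ T0; apply=> //; exact: TE.
  have [_ _ _] := agood n; apply=> //; rewrite ltNge; apply/negP => /nmin.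
  by rewrite ltnn.
by move=> [->//|[n _ <-]].
Qed.

End tenuous_sets.

(** * Invariance of Urysohn spaces under isometry *)

Section isometry_invariance.
Context {K : realType}.
Implicit Types (R S : set K) (X Y : metricType K).

Lemma isometric_sym X Y : isometric X Y -> isometric Y X.
Proof.
move=> [f fE [g fK gK]]; exists g; last by exists f.
by move=> x y; rewrite -fE !gK.
Qed.

Lemma isometric_ultrametric X Y (f : X -> Y) : isometric_embedding f ->
  ultrametric Y -> ultrametric X.
Proof. by move=> fE um x y z; rewrite -!fE. Qed.

Lemma isometric_valued_in R X Y (f : X -> Y) : isometric_embedding f ->
  valued_in R Y -> valued_in R X.
Proof. by move=> fE RY x y; rewrite -fE. Qed.

Lemma isometric_separable X Y : isometric X Y -> separable X -> separable Y.
Proof.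
move=> [f fE [g fK gK]] /separableP[D cD dD]; apply/separableP.
exists (f @` D); first exact: card_le_trans (card_image_le _ _) cD.
move=> y e e0; have [x Dx xe] := dD (g y) e e0.
by exists (f x); [exists x|rewrite -(gK y) fE].
Qed.

Lemma isometric_complete X Y : isometric X Y ->
  complete_space X -> complete_space Y.
Proof.
move=> [f fE [g fK gK]] cX F FF cF.
have [|x gx] := cX (g @ F).
  apply/cauchy_ballP => e e0.
  have /cauchy_ballP/(_ e e0)[[A B] /= [FA FB] AB] := cF.
  exists (g @` A, g @` B) => /=.
    split; rewrite /fmap/=.
      by apply: filterS FA => z Az; exists z.
    by apply: filterS FB => z Bz; exists z.
  move=> [x y] /= [[z Az <-] [t Bt <-]]; have /= := AB (z, t) (conj Az Bt).
  by rewrite !ballEmdist /= -fE !gK.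
exists (f x); apply/metricType_numDomainType.fcvgrPdist_lt => e e0.
have gxe := metricType_numDomainType.cvgr_dist_lt gx e0.
by apply: filterS (gxe _) => y; rewrite -fE gK.
Qed.

Lemma isometric_injective_for (C : metricType K -> Prop) X Y :
  isometric X Y -> injective_for C X -> injective_for C Y.
Proof.
move=> [f fE [g fK gK]] [[x _] iX]; split; first by exists (f x).
move=> A B CA CB phi h phiE hE.
have [|F FE Fphi] := iX A B CA CB phi (g \o h) phiE.
  by move=> a b; rewrite /= -fE !gK.
exists (f \o F); first by move=> a b; rewrite /= fE.
by rewrite -compA Fphi; apply/funext => a /=; rewrite gK.
Qed.

Lemma isometric_separable_urysohn R X Y : isometric X Y ->
  separable_urysohn R X -> separable_urysohn R Y.
Proof.
move=> XY [um vX sX cX iX]; have [g gE _] := isometric_sym XY; split.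
- exact: isometric_ultrametric um.
- exact: isometric_valued_in vX.
- exact: isometric_separable sX.
- exact: isometric_complete cX.
- exact: isometric_injective_for iX.
Qed.

Lemma isometric_preimage X Y (f : X -> Y) (A : set Y) :
  isometric_embedding f -> bijective f ->
  isometric (set_type A : metricType K) (set_type (f @^-1` A) : metricType K).
Proof.
move=> fE [g fK gK].
have gA (y : set_type A) : g (set_val y) \in f @^-1` A.
  by rewrite inE /= gK; exact: set_valP.
have fA (x : set_type (f @^-1` A)) : f (set_val x) \in A.
  by rewrite inE; exact: (set_valP x).
exists (fun y => SigSub (gA y)).
  move=> x y; change (mdist (g (set_val x)) (g (set_val y)) =
    mdist (set_val x) (set_val y)).
  by rewrite -fE !gK.
exists (fun x => SigSub (fA x)) => z; apply: val_inj => /=.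
  by rewrite gK.
by rewrite fK.
Qed.

Lemma isometric_petaloid R X Y : isometric X Y -> petaloid R X -> petaloid R Y.
Proof.
move=> /isometric_sym[g gE gbij] [um vX [P [P1 P2 P3 P4]]]; split.
- exact: isometric_ultrametric um.
- exact: isometric_valued_in vX.
exists (fun S => g @^-1` P S); split.
- move=> S RS S0; apply: isometric_separable_urysohn (P1 S RS S0).
  exact: isometric_preimage.
- by rewrite -preimage_bigcup P2 preimage_setT.
- by move=> S T RS RT; rewrite -preimage_setI P3.
move=> S T y RS RT Ty; have [r rTS gr] := P4 S T (g y) RS RT Ty.
exists r => //; rewrite -gr /dist_to_set; congr ereal_inf.
have [h gK hK] := gbij.
apply/seteqP; split=> _ /= [a Sa <-].
  by exists (g a) => //; rewrite gE.
by exists (h a); rewrite /preimage/= ?hK// -gE hK.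
Qed.

Lemma isometric_urysohn R X Y : isometric X Y -> urysohn R X -> urysohn R Y.
Proof.
move=> XY [h1 h2]; split=> cR.
  exact: isometric_separable_urysohn (h1 cR).
exact: isometric_petaloid (h2 cR).
Qed.

End isometry_invariance.

(** * Coordinate functions and the square of a space *)

Section coordinates.
Context {K : realType}.
Implicit Types (R : set K) (X Y : metricType K).

(** For a range set [R], this says through [tenuousP] that the support of [f] together with [0] is a
    tenuous range set inside [R]. *)
Definition tenuous_support R (f : K -> nat) : Prop :=
  (forall s, f s <> 0%N -> R s /\ 0 < s) /\
  finite_above [set s | f s <> 0%N].

(** Quantifying over [r] makes the distance the largest index of disagreement without having to
    exhibit a maximum. *)
Definition coordinates R X (c : X -> K -> nat) : Prop :=
  (forall x y r, 0 <= r ->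
    (mdist x y <= r <-> forall s, r < s -> c x s = c y s)) /\
  range c = tenuous_support R.

Lemma coordinates_support R X (c : X -> K -> nat) x :
  coordinates R c -> tenuous_support R (c x).
Proof. by move=> [_ <-]; exists x. Qed.

Lemma coordinates_inj R X (c : X -> K -> nat) :
  coordinates R c -> injective c.
Proof.
move=> cc x y cxy; apply: mdist_positivity; apply/eqP.
by rewrite eq_le mdist_ge0 andbT; apply/(proj1 cc) => // s _; rewrite cxy.
Qed.

(** Both families have the same range and determine the distance in the same way, so matching points
    with equal coordinates is an isometry. *)
Lemma coordinates_isometric R X Y (c : X -> K -> nat) (e : Y -> K -> nat) :
  coordinates R c -> coordinates R e -> isometric X Y.
Proof.
move=> cc ee.
have /choice[f fc] : forall x, exists y, e y = c x.
  move=> x; have := coordinates_support x cc.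
  by rewrite -(proj2 ee) => -[y _ ey]; exists y.
have /choice[g ge] : forall y, exists x, c x = e y.
  move=> y; have := coordinates_support y ee.
  by rewrite -(proj2 cc) => -[x _ cx]; exists x.
exists f; last first.
  by exists g => x; [apply: (coordinates_inj cc)|apply: (coordinates_inj ee)];
    rewrite ?fc ?ge ?fc.
move=> x y; apply/eqP; rewrite eq_le; apply/andP; split.
  by apply/(proj1 ee); rewrite ?mdist_ge0// !fc;
    apply/(proj1 cc); rewrite ?mdist_ge0.
by apply/(proj1 cc); rewrite ?mdist_ge0// -!fc;
  apply/(proj1 ee); rewrite ?mdist_ge0.
Qed.

(** Any bijection is corrected by the transposition of [0] with the image of [(0, 0)]. *)
Lemma nat_pairing :
  exists2 h : nat * nat -> nat, bijective h & h (0, 0)%N = 0%N.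
Proof.
have /card_set_bijP[f] := card_nat2; rewrite setTT_bijective => fbij.
pose sw (a n : nat) := if n == a then 0%N else if n == 0%N then a else n.
have swK a : involutive (sw a).
  move=> n; rewrite /sw; have [->|na] := eqVneq n a.
    by case: (eqVneq 0%N a).
  have [->|n0] := eqVneq n 0%N; first by rewrite eqxx.
  by rewrite (negbTE na) (negbTE n0).
exists (sw (f (0, 0)%N) \o f); last by rewrite /sw/= eqxx.
apply: bij_comp fbij; exact: (inv_bij (swK _)).
Qed.

(** As [h] sends only [(0, 0)] to [0], the support of a paired function is the union of the two
    supports, so tenuous supports pair and split into tenuous supports. *)
Lemma coordinates_prod R X (c : X -> K -> nat) : coordinates R c ->
  exists e : (X * X)%type -> K -> nat,
    coordinates R (X := (X * X)%type : metricType K) e.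
Proof.
move=> cc; have [h [g hK gK] h0] := nat_pairing.
have g0 : g 0%N = (0, 0)%N by have := hK (0, 0)%N; rewrite h0.
exists (fun p s => h (c p.1 s, c p.2 s)); split.
  move=> [x1 x2] [y1 y2] r r0.
  change (Num.max (mdist x1 y1) (mdist x2 y2) <= r <-> forall s, r < s ->
    h (c x1 s, c x2 s) = h (c y1 s, c y2 s)).
  rewrite ge_max; split.
    move=> /andP[/(proj1 cc _ _ _ r0) h1 /(proj1 cc _ _ _ r0) h2] s rs.
    by rewrite h1// h2.
  move=> xy; apply/andP; split; apply/(proj1 cc) => // s rs;
    by have /(can_inj hK)[] := xy s rs.
apply/seteqP; split=> [_ /= [[x y] _ <-]|f [f0 ff]].
  have [x0 xf] := coordinates_support x cc.
  have [y0 yf] := coordinates_support y cc.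
  have nz s : h (c x s, c y s) <> 0%N -> c x s <> 0%N \/ c y s <> 0%N.
    move=> hn; have [xs|/eqP] := eqVneq (c x s) 0%N; last by left.
    by right=> ys; apply: hn; rewrite xs ys.
  split=> [s /nz[/x0|/y0]//|e e0].
  apply: (@sub_finite_set _ _ ([set s | c x s <> 0%N /\ e <= s] `|`
    [set s | c y s <> 0%N /\ e <= s])); last first.
    by rewrite finite_setU; split; [exact: xf|exact: yf].
  by move=> s /= [/nz[] ? ?]; [left|right].
have gf s : (g (f s)).1 <> 0%N \/ (g (f s)).2 <> 0%N -> f s <> 0%N.
  by move=> + fs; rewrite fs g0 /= => -[].
have ts (p : nat * nat -> nat) : p (0, 0)%N = 0%N ->
    exists x, c x = (fun s => p (g (f s))).
  move=> p0; have pz s : p (g (f s)) <> 0%N -> f s <> 0%N.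
    by move=> + fs; rewrite fs g0 p0.
  have : tenuous_support R (fun s => p (g (f s))).
    split=> [s /pz/f0//|e e0].
    by apply: sub_finite_set (ff e e0) => s /= [/pz].
  by rewrite -(proj2 cc) => -[x _ cx]; exists x.
have [x cx] := ts fst erefl; have [y cy] := ts snd erefl.
exists (x, y) => //=; apply/funext => s.
by rewrite cx cy -surjective_pairing gK.
Qed.

End coordinates.

(** * A criterion for labels of balls to be coordinates *)

Section coordinates_of_labels.
(** [c_base] and [c_ext] realise finite supports, one label at a time; [c_lim] passes to the limit.
    It concerns sequences supported inside one tenuous set, because in a petaloid space they stay in
    a single complete petal. *)
Context {K : realType} (R : set K) (X : metricType K) (c : X -> K -> nat)
  (c_supp : forall x s, c x s <> 0%N -> R s /\ 0 < s)
  (c_lt : forall x y s, mdist x y < s -> c x s = c y s)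
  (c_neq : forall x y, 0 < mdist x y -> c x (mdist x y) <> c y (mdist x y))
  (c_fin : forall x, finite_above [set s | c x s <> 0%N])
  (c_base : exists x, forall s, c x s = 0%N)
  (c_ext : forall x r n, R r -> 0 < r -> exists y,
    [/\ mdist x y <= r, c y r = n & forall s, s < r -> c y s = 0%N])
  (c_lim : forall f, tenuous_support R f -> forall u : nat -> X,
    (forall n s, c (u n) s <> 0%N -> f s <> 0%N) ->
    cauchy_seq u -> exists l, seq_limit u l).

Let dist_labels x y r : 0 <= r ->
  (mdist x y <= r <-> forall s, r < s -> c x s = c y s).
Proof.
move=> r0; split=> [xyr s rs|h]; first by apply: c_lt; exact: le_lt_trans rs.
rewrite leNgt; apply/negP => rxy.
exact: (c_neq (le_lt_trans r0 rxy)) (h _ rxy).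
Qed.

(** The head [m] is the least index, so the labels above it are realised first; [c_ext] then sets
    the label at [m] and keeps those above. *)
Let finite_support_label (l : seq K) (g : K -> nat) :
  sorted <=%R l -> (forall s, g s <> 0%N -> s \in l) ->
  (forall s, g s <> 0%N -> R s /\ 0 < s) -> exists x, c x = g.
Proof.
elim: l g => [|m l ih] g.
  move=> _ gl _; have [x x0] := c_base; exists x; apply/funext => s.
  by rewrite x0; apply: contrapT => /nesym/gl.
move=> ml gl gR; have sl := path_sorted ml.
have [gm|/eqP gm] := eqVneq (g m) 0%N.
  apply: ih => // s gs; have := gl s gs; rewrite in_cons => /orP[/eqP sm|//].
  by move: gs; rewrite sm.
have [||x xg] := ih (fun s => if s == m then 0%N else g s) sl.
- move=> s; case: eqP => // sm gs; have := gl s gs.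
  by rewrite in_cons => /orP[/eqP|].
- by move=> s; case: eqP => // sm /gR.
have [Rm m0] := gR _ gm; have [y [xy ym y0]] := c_ext x (g m) Rm m0.
exists y; apply/funext => s; case: (ltgtP s m) => [sm|ms|->//].
  rewrite y0//; apply: contrapT => /nesym/gl; rewrite in_cons.
  case/orP => [/eqP sE|]; first by rewrite sE ltxx in sm.
  by move/(allP (order_path_min le_trans ml)); rewrite leNgt sm.
by rewrite -(c_lt (le_lt_trans xy ms)) xg gt_eqF.
Qed.

(** The truncations of [f] to indices at least [1/(n+1)] have finite support, so they are realised
    by points [u n]. These form a Cauchy sequence, and its limit has coordinates [f]. *)
Lemma coordinates_of_labels : coordinates R c.
Proof.
split; first exact: dist_labels.
apply/seteqP; split=> [_ [x _ <-]|f ff].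
  by split; [exact: c_supp|exact: c_fin].
have [f0 fa] := ff.
have inv0 (n : nat) : 0 < n.+1%:R^-1 :> K by rewrite invr_gt0.
have smallinv (e : K) : 0 < e -> exists n : nat, n.+1%:R^-1 < e.
  by move=> /invn_small[N hN]; exists N; exact: hN.
have /choice[u cu] : forall n : nat, exists x,
    c x = fun s => if n.+1%:R^-1 <= s then f s else 0%N.
  move=> n; have /finite_seqP[l lE] := fa _ (inv0 n).
  apply: (@finite_support_label (sort <=%R l)).
  - exact/sort_sorted/le_total.
  - move=> s; case: ifP => // ns fs; rewrite mem_sort.
    by have : [set` l] s by rewrite -lE.
  - by move=> s; case: ifP => // _ /f0.
have [||l lu] := c_lim ff (u := u).
- by move=> n s; rewrite cu; case: ifP.
- move=> e e0; have [N Ne] := smallinv e e0; exists N => n m Nn Nm.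
  apply: le_lt_trans Ne; apply/dist_labels => [|s Ns]; first exact: ltW.
  by rewrite !cu !ifT// (le_trans _ (ltW Ns))// lef_pV2 ?posrE// ler_nat.
exists l => //; apply/funext => s; have [s0|s0] := leP s 0.
  have zero (k : nat) : (k <> 0%N -> R s /\ 0 < s) -> k = 0%N.
    by move=> h; apply: contrapT => /h[_]; rewrite ltNge s0.
  by rewrite (zero _ (@c_supp l s)) (zero _ (@f0 s)).
have [N Ns] := smallinv s s0; have [M lM] := lu s s0.
rewrite (c_lt (lM (maxn N M) (leq_maxr _ _))) cu ifT//.
by rewrite (le_trans _ (ltW Ns))// lef_pV2 ?posrE// ler_nat ltnS leq_maxl.
Qed.

End coordinates_of_labels.

(** * Ranks inside an infinite set of natural numbers *)

Section rank.
Context (A : pred nat).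

Let rank n := count A (iota 0 n).

Let rankD k n : rank (k + n) = (rank k + count A (iota k n))%N.
Proof. by rewrite /rank iotaD count_cat. Qed.

Lemma count_iota_lt i j : A i -> (i < j)%N -> (rank i < rank j)%N.
Proof.
move=> Ai ij; rewrite -(subnKC (ltnW ij)) rankD.
by rewrite -[(j - i)%N]prednK ?subn_gt0//= Ai addnCA leq_addr.
Qed.

(** The first element of [A] from [k] on has the rank of [k], and stepping just past it raises the
    rank by one. *)
Lemma count_iota_surj n : (forall N, exists2 i, (N <= i)%N & A i) ->
  exists2 i, A i & rank i = n.
Proof.
move=> infA; have next k : exists2 i, A i & rank i = rank k.
  have ex : exists i, (k <= i)%N && A i.
    by have [i ki Ai] := infA k; exists i; rewrite ki.
  case: (ex_minnP ex) => i /andP[ki Ai] imin; exists i => //.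
  rewrite -(subnKC ki) rankD; apply/eqP; rewrite -[eqbRHS]addn0 eqn_add2l.
  rewrite -leqn0 leqNgt -has_count; apply/hasPn => j.
  rewrite mem_iota subnKC// => /andP[kj ji]; apply/negP => Aj.
  by have := imin j; rewrite kj Aj => /(_ isT); rewrite leqNgt ji.
elim: n => [|n [i Ai <-]]; first by have := next 0%N.
have [j Aj jr] := next i.+1; exists j => //.
by rewrite jr -addn1 rankD/= Ai addn0 addn1.
Qed.

End rank.

(** * Labels of the open balls inside a closed ball *)

Section ball_labels.
Context {K : realType} (X : metricType K) (um : ultrametric X).

(* The open [r]-balls of a closed [r]-ball [C] are numbered in the order in
   which they are hit by the sequence [u x], the same one for all [x] in [C]. *)
Lemma ball_labels (r : K) (u : X -> nat -> X) :
  (forall x y, mdist x y <= r -> u x = u y) ->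
  (forall x, exists i, mdist x (u x i) < r) ->
  (forall x N, exists2 y, mdist x y <= r &
    forall i, (i < N)%N -> r <= mdist y (u x i)) ->
  exists c : X -> nat,
  [/\ forall x y, mdist x y < r -> c x = c y,
      forall x y, mdist x y = r -> c x <> c y,
      forall x n, exists2 y, mdist x y <= r & c y = n &
      forall x i, mdist x (u x i) < r ->
        (forall j, (j < i)%N -> mdist x (u x j) <> r) -> c x = 0%N].
Proof.
move=> u_eq u_cov u_inf.
have /choice[idx idxP] : forall x, exists i, mdist x (u x i) < r /\
    forall j, mdist x (u x j) < r -> (i <= j)%N.
  by move=> x; case: (ex_minnP (u_cov x)) => i ? ?; exists i.
(* The indices at which an open ball of the closed ball around [x] is first hit; they depend only on
   that closed ball. *)
pose A x : pred nat := fun j => `[< exists2 z, mdist x z <= r & idx z = j >].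
have A_eq x y : mdist x y <= r -> A x = A y.
  move=> xy; apply/funext => j; apply/asbool_equiv_eq; split=> -[z xz zj];
    exists z => //; apply: ultrametric_le xz => //.
  by rewrite metric_sym.
have Aidx x y : mdist x y <= r -> A x (idx y).
  by move=> xy; apply/asboolP; exists y.
have r0 (x : X) : 0 <= r.
  have [i] := u_cov x; move=> /ltW; apply: le_trans; exact: mdist_ge0.
have Axx x : A x (idx x) by apply: Aidx; rewrite mdistxx (r0 x).
have idx_eq x y : mdist x y <= r -> idx x = idx y -> mdist x y < r.
  move=> xy ixy; apply: (ultrametric_lt um (proj1 (idxP x))).
  by rewrite (u_eq _ _ xy) ixy metric_sym; exact: (proj1 (idxP y)).
(* The label is the rank of the first hit among all first hits, so that no natural number is
   skipped. *)
exists (fun x => count (A x) (iota 0 (idx x))); split.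
- move=> x y xy; rewrite (A_eq x y (ltW xy)); congr count; congr iota.
  have le_idx z t : mdist z t < r -> (idx z <= idx t)%N.
    move=> zt; apply: (proj2 (idxP z)); apply: (ultrametric_lt um zt).
    by rewrite (u_eq _ _ (ltW zt)); exact: (proj1 (idxP t)).
  by apply/eqP; rewrite eqn_leq !le_idx// metric_sym.
- move=> x y xy; have xyr : mdist x y <= r by rewrite xy.
  rewrite -(A_eq _ _ xyr); case: (ltngtP (idx x) (idx y)) => ixy.
  + by move/eqP; rewrite ltn_eqF// count_iota_lt.
  + by move/eqP; rewrite gtn_eqF// count_iota_lt// Aidx.
  + by move: (idx_eq _ _ xyr ixy); rewrite xy ltxx.
- move=> x n; have [|i /asboolP[z xz zi] <-] := @count_iota_surj (A x) n.
    move=> N; have [y xy yN] := u_inf x N; exists (idx y); last exact: Aidx.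
    rewrite leqNgt; apply/negP => /yN; rewrite (u_eq _ _ xy) leNgt.
    by rewrite (proj1 (idxP y)).
  by exists z => //; rewrite -(A_eq _ _ xz) zi.
(* An element of [A x] below [idx x] would be the first hit of another open ball, hence an index
   below [i] of a term at distance exactly [r] from [x]. *)
move=> x i xi xj; apply/eqP; rewrite -leqn0 leqNgt -has_count.
apply/hasPn => j; rewrite mem_iota add0n => /= jx.
apply/negP => /asboolP[z xz zj].
apply: (xj j); first by rewrite (leq_trans jx)// (proj2 (idxP x)).
apply/eqP; rewrite eq_le; apply/andP; split.
  apply: (ultrametric_le um xz); rewrite (u_eq _ _ xz) -zj ltW//.
  exact: (proj1 (idxP z)).
by rewrite leNgt; apply/negP => /(proj2 (idxP x)); rewrite leqNgt jx.
Qed.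

(** Pigeonhole: the [N.+1] open balls around the [y i] are disjoint, so [N] terms of the sequence
    cannot meet them all. *)
Lemma equilateral_avoid (r : K) N (y : 'I_N.+1 -> X) (u : nat -> X) :
  (forall i j, i != j -> mdist (y i) (y j) = r) ->
  exists i, forall k, (k < N)%N -> r <= mdist (y i) (u k).
Proof.
move=> yr; apply: contrapT => no.
have /choice[k kP] : forall i, exists k : 'I_N, mdist (y i) (u k) < r.
  move=> i; apply: contrapT => nk; apply: no; exists i => k kN.
  by rewrite leNgt; apply/negP => yk; apply: nk; exists (Ordinal kN).
have : (#|'I_N.+1| <= #|'I_N|)%N.
  apply: (leq_card k) => i j kij; apply/eqP/negPn/negP => ij.
  have := ultrametric_lt um (kP i); rewrite kij => /(_ (y j)).
  by rewrite metric_sym (yr _ _ ij) ltxx kP => /(_ isT).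
by rewrite !card_ord ltnn.
Qed.

End ball_labels.

(** * Finite equilateral spaces as test spaces for injectivity *)

Section equilateral_space.
Context {K : realType}.

(** Carrying [r] in the type lets the metric instance read off the common distance. *)
Definition equilateral (r : {posnum K}) (n : nat) := 'I_n.

HB.instance Definition _ r n := Choice.on (equilateral r n).

Definition equilateral_dist r n (i j : equilateral r n) : K :=
  if i == j then 0 else r%:num.

Lemma equilateral_distxx r n (i : equilateral r n) : equilateral_dist i i = 0.
Proof. by rewrite /equilateral_dist eqxx. Qed.

Lemma equilateral_dist_eq0 r n (i j : equilateral r n) :
  equilateral_dist i j = 0 -> i = j.
Proof.
by rewrite /equilateral_dist; case: eqP => // _ /eqP; rewrite gt_eqF.
Qed.

Lemma equilateral_dist_sym r n (i j : equilateral r n) :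
  equilateral_dist i j = equilateral_dist j i.
Proof. by rewrite /equilateral_dist eq_sym. Qed.

Lemma equilateral_dist_max r n (j i k : equilateral r n) :
  equilateral_dist i k <= Num.max (equilateral_dist i j) (equilateral_dist j k).
Proof.
rewrite /equilateral_dist; have [->|ij] := eqVneq i j.
  by rewrite le_max lexx orbT.
by rewrite le_max; case: ifP => _; rewrite ?lexx //; apply/orP; left.
Qed.

Lemma equilateral_triangle r n (j i k : equilateral r n) :
  equilateral_dist i k <= equilateral_dist i j + equilateral_dist j k.
Proof.
apply: le_trans (equilateral_dist_max j i k) _.
have ge0 (a b : equilateral r n) : 0 <= equilateral_dist a b.
  by rewrite /equilateral_dist; case: ifP.
by rewrite ge_max; apply/andP; split; rewrite ?lerDl ?lerDr ge0.
Qed.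

HB.instance Definition _ r n := isMetric.Build K (equilateral r n)
  (@equilateral_distxx r n) (@equilateral_dist_eq0 r n)
  (@equilateral_dist_sym r n) (@equilateral_triangle r n).

(** The map from one point to [x] is extended to [n.+1] equidistant points; the [n] new points are
    the [y i]. *)
Lemma injective_equilateral (S : set K) (X : metricType K) (r : K) n (x : X) :
  injective_for (finite_valued_ultrametric S) X -> S 0 -> S r -> 0 < r ->
  exists2 y : 'I_n -> X, forall i j, i != j -> mdist (y i) (y j) = r &
    forall i, mdist x (y i) <= r.
Proof.
move=> [_ iX] S0 Sr r0; pose p := PosNum r0.
have CE m : finite_valued_ultrametric S (equilateral p m : metricType K).
  split; first exact: finite_finset.
    by move=> i j k; exact: equilateral_dist_max.
  by move=> i j; rewrite /mdist/= /equilateral_dist; case: ifP.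
have [||F FE Fx] := iX _ _ (CE 1%N) (CE n.+1)
    (fun=> ord0) (fun=> x).
- by move=> i j; rewrite !mdistxx (ord1 i) (ord1 j) mdistxx.
- by move=> i j; rewrite !mdistxx (ord1 i) (ord1 j) mdistxx.
have xF : x = F ord0 by rewrite -[LHS]/((fun=> x) (ord0 : equilateral p 1)) -Fx.
exists (fun i => F (lift ord0 i)) => [i j ij|i].
  rewrite FE /mdist/= /equilateral_dist; case: eqP => // /lift_inj ijE.
  by rewrite ijE eqxx in ij.
by rewrite xF FE /mdist/= /equilateral_dist; case: eqP => _ //; exact: ltW.
Qed.

End equilateral_space.

(** * Labels for all radii at once *)

Section label_family.
Context {K : realType} (R : set K) (X : metricType K) (um : ultrametric X).

(** The last clause is the vanishing criterion for labels in contrapositive form: a nonzero label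
    forces an earlier term in another open ball. *)
Lemma label_family (u : K -> X -> nat -> X) :
  (forall r x y, R r -> 0 < r -> mdist x y <= r -> u r x = u r y) ->
  (forall r x, R r -> 0 < r -> exists i, mdist x (u r x i) < r) ->
  (forall r x N, R r -> 0 < r -> exists2 y, mdist x y <= r &
    forall i, (i < N)%N -> r <= mdist y (u r x i)) ->
  exists c : X -> K -> nat,
  [/\ forall x s, c x s <> 0%N -> R s /\ 0 < s,
      forall x y s, mdist x y < s -> c x s = c y s,
      forall x y, R (mdist x y) -> 0 < mdist x y ->
        c x (mdist x y) <> c y (mdist x y),
      forall x s n, R s -> 0 < s -> exists2 y, mdist x y <= s & c y s = n &
      forall x s i, c x s <> 0%N -> mdist x (u s x i) < s ->
        exists2 j, (j < i)%N & mdist x (u s x j) = s].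
Proof.
move=> u_eq u_cov u_inf.
have /choice[c cP] : forall s, exists c : X -> nat,
    (forall x, c x <> 0%N -> R s /\ 0 < s) /\ (R s -> 0 < s ->
  [/\ forall x y, mdist x y < s -> c x = c y,
      forall x y, mdist x y = s -> c x <> c y,
      forall x n, exists2 y, mdist x y <= s & c y = n &
      forall x i, mdist x (u s x i) < s ->
        (forall j, (j < i)%N -> mdist x (u s x j) <> s) -> c x = 0%N]).
  move=> s; have [[Rs s0]|ns] := pselect (R s /\ 0 < s); last first.
    by exists (fun=> 0%N); split=> // Rs s0; exfalso; apply: ns.
  have [|||c cc] := @ball_labels _ _ um s (u s); last by exists c.
  - by move=> x y; exact: u_eq.
  - by move=> x; exact: u_cov.
  - by move=> x N; exact: u_inf.
exists (fun x s => c s x); split.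
- by move=> x s /(proj1 (cP s)).
- move=> x y s xy; have [[Rs s0]|ns] := pselect (R s /\ 0 < s).
    by have [cl _ _ _] := proj2 (cP s) Rs s0; exact: cl.
  have z t : c s t = 0%N by apply: contrapT => /(proj1 (cP s)).
  by rewrite !z.
- by move=> x y Rd d0; have [_ cn _ _] := proj2 (cP _) Rd d0; exact: cn.
- by move=> x s n Rs s0; have [_ _ cs _] := proj2 (cP _) Rs s0; exact: cs.
move=> x s i cxs xi; apply: contrapT => no.
have [Rs s0] := proj1 (cP s) _ cxs.
have [_ _ _ cz] := proj2 (cP s) Rs s0; apply: cxs; apply: cz xi _ => j ji xj.
by apply: no; exists j.
Qed.

End label_family.

(** * Coordinates of a separable Urysohn space *)

Section separable_coordinates.
Context {K : realType} (R : set K) (X : metricType K).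

(** One dense sequence numbers the balls of all radii. The nonzero labels of [u i] sit at distances
    to earlier terms, hence are finitely many, and every point shares its labels from [e] on with
    some [u i]. *)
Lemma separable_coordinates : range_set R -> separable_urysohn R X ->
  exists c : X -> K -> nat, coordinates R c.
Proof.
move=> [_ R0] [um vX sX cX iX]; have [u ud] := dense_seq sX (proj1 iX).
have [//|r x _ r0|r x N Rr r0|] := @label_family _ R _ um (fun _ _ => u).
- exact: ud.
- have [y yr xy] := injective_equilateral N.+1 x iX R0 Rr r0.
  by have [i iN] := equilateral_avoid um u yr; exists (y i).
move=> c [c_supp c_lt c_neq c_surj c_zero]; exists c.
have c_u i s : c (u i) s <> 0%N -> exists2 j, (j < i)%N & mdist (u i) (u j) = s.
  move=> h; apply: (c_zero _ _ i h); rewrite mdistxx.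
  by have [] := c_supp _ _ h.
apply: coordinates_of_labels => //.
- by move=> x y; apply: c_neq.
- move=> x e e0; have [i xi] := ud x e e0.
  apply: (@sub_finite_set _ _ [set mdist (u i) (u j) | j in `I_i]); last first.
    exact/finite_image/finite_II.
  move=> s /= [cs es]; rewrite (c_lt _ (u i)) in cs; last exact: lt_le_trans es.
  by have [j ji <-] := c_u _ _ cs; exists j.
- exists (u 0%N) => s; apply: contrapT => /c_u[j].
  by rewrite ltn0.
- move=> x r n Rr r0; have [y xy yn] := c_surj x r n Rr r0.
  (* With [i] least in the open ball, a nonzero label of [u i] below [r] would produce an earlier
     term in the same ball. *)
  case: (ex_minnP (ud y r r0)) => i yi imin; exists (u i); split.
  + exact: (ultrametric_le um xy (ltW yi)).
  + by rewrite -(c_lt _ _ _ yi).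
  + move=> s sr; apply: contrapT => /c_u[j ji uj].
    have : mdist y (u j) < r by apply: (ultrametric_lt um yi); rewrite uj.
    by move/imin; rewrite leqNgt ji.
by move=> f _ v _; exact: cauchy_seq_cvg.
Qed.

End separable_coordinates.

(** * Tenuous subsets of the range set *)

Section TEN.
Context {K : realType} (R : set K) (hR : range_set R).

Lemma TENP (S : set K) : TEN R S <-> [/\ S 0, S `<=` R & finite_above S].
Proof.
split=> [[rS /(tenuousP rS) fS SR]|[S0 SR fS]]; first by split=> //; case: rS.
have rS : range_set S by split=> // s /SR/(proj1 hR).
by split=> //; apply/tenuousP.
Qed.

Lemma TENU (S T : set K) : TEN R S -> TEN R T -> TEN R (S `|` T).
Proof.
move=> /TENP[S0 SR fS] /TENP[T0 TR fT]; apply/TENP; split.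
- by left.
- by rewrite subUset.
move=> e e0; apply: (@sub_finite_set _ _ ([set s | S s /\ e <= s] `|`
    [set s | T s /\ e <= s])).
  by move=> s /= [[Ss|Ts] es]; [left|right].
by rewrite finite_setU; split; [exact: fS|exact: fT].
Qed.

Lemma TEN_sub (S T : set K) : TEN R T -> S `<=` T -> S 0 -> TEN R S.
Proof.
move=> /TENP[T0 TR fT] ST S0; apply/TENP; split=> //.
  exact: subset_trans TR.
by move=> e e0; apply: sub_finite_set (fT e e0) => s [/ST Ts es].
Qed.

Lemma TEN_set2 r : R r -> TEN R [set 0; r].
Proof.
move=> Rr; apply/TENP; split; first by left.
  by move=> s [->|->] //; exact: (proj2 hR).
by move=> e e0; apply: (@sub_finite_set _ _ [set 0; r]) => // s [].
Qed.

Lemma neq_set0 (S : set K) t : S t -> 0 < t -> S <> [set 0].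
Proof. by move=> + t0 S0; rewrite S0 /= => t00; rewrite t00 ltxx in t0. Qed.

Lemma uncountable_other r : ~ countable R -> exists t, [/\ R t, 0 < t & t != r].
Proof.
move=> ucR; apply: contrapT => no; apply: ucR.
apply: (@sub_countable _ _ _ [set 0; r]); last exact: finite_set_countable.
apply: subset_card_le => s Rs; have := proj1 hR _ Rs; rewrite /= le_eqVlt.
case/orP => [/eqP <-|s0]; first by left.
by right; apply: contrapT => /eqP sr; apply: no; exists s.
Qed.

End TEN.

(** * Petals and the coordinates of a petaloid space *)

Section petals.
Context {K : realType} (R : set K) (X : metricType K) (P : set K -> set X).
Context (hR : range_set R) (ucR : ~ countable R).
Context (um : ultrametric X) (vX : valued_in R X) (hP : is_petal R P).

Lemma petal_sub S T : TEN R S -> TEN R T -> S `<=` T -> P S `<=` P T.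
Proof.
have [_ _ P3 _] := hP; move=> RS RT ST.
by rewrite -{1}(setIidl ST) -P3// => y [].
Qed.

Lemma petal_cover x S : TEN R S -> exists T, [/\ TEN R T, S `<=` T & P T x].
Proof.
move=> RS; have [_ P2 _ _] := hP; have : setT x by [].
rewrite -P2 => -[T RT Tx]; exists (T `|` S).
have RTS := TENU hR RT RS; split=> //.
by apply: petal_sub Tx => // s; left.
Qed.

Lemma petal_complete S : TEN R S -> S <> [set 0] ->
  complete_space (set_type (P S) : metricType K).
Proof. by have [P1 _ _ _] := hP; move=> RS /(P1 _ RS)[]. Qed.

(** For [S = [set 0]], where (P1) is silent, the petal lies in those of [[set 0; a]] and
    [[set 0; b]] with [a] and [b] distinct and positive, and the two value sets share only [0]. *)
Lemma petal_valued S x y : TEN R S -> P S x -> P S y -> S (mdist x y).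
Proof.
have [P1 _ _ _] := hP.
have nontriv T : TEN R T -> T <> [set 0] -> P T x -> P T y -> T (mdist x y).
  move=> RT /(P1 _ RT)[_ vT _ _ _] Tx Ty.
  exact: (vT (SigSub (mem_set Tx)) (SigSub (mem_set Ty))).
move=> RS Sx Sy; have [S0|] := pselect (S = [set 0]); last first.
  by move=> S0; exact: nontriv.
have two t : R t -> 0 < t -> [set 0; t] (mdist x y).
  move=> Rt t0; have Rt2 := TEN_set2 hR Rt.
  have St : S `<=` [set 0; t] by rewrite S0 => s ->; left.
  apply: nontriv => //; try exact: (petal_sub RS Rt2 St).
  by apply: (neq_set0 _ t0); right.
have [a [Ra a0 _]] := uncountable_other hR 0 ucR.
have [b [Rb b0 /eqP ba]] := uncountable_other hR a ucR.
rewrite S0; have [//|/= xa] := two a Ra a0.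
by have [//|/= xb] := two b Rb b0; exfalso; apply: ba; rewrite -xa -xb.
Qed.

(** The distance from [x] to the petal is at most [r], and by (P4) it cannot equal the positive
    value [r] of [S]. *)
Lemma petal_near S x q r : TEN R S -> S r -> 0 < r -> P S q -> mdist x q <= r ->
  exists2 p, P S p & mdist x p < r.
Proof.
move=> RS Sr r0 Sq xq; have [_ _ _ P4] := hP.
have [T [RT _ Tx]] := petal_cover x RS.
have [e eTS xS] := P4 S T x RS RT Tx.
apply: (dist_to_set_lt xS); rewrite lt_neqAle.
rewrite (le_trans (dist_to_set_le xS Sq) xq) andbT; apply/eqP => er.
case: eTS => [/= e0|[_ nSe]]; last by apply: nSe; rewrite er.
by rewrite -er e0 ltxx in r0.
Qed.

(** By (P4) the distance is [0], and then completeness applies, or a positive [e] in [T] outside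
    [S]. Distances to the petal lie in [T], which has a least available value above [e], so the
    infimum [e] is attained. *)
Lemma petal_attained S T x : TEN R S -> TEN R T -> S <> [set 0] ->
  S `<=` T -> P T x ->
  P S x \/ exists p, [/\ P S p, 0 < mdist x p & (T `\` S) (mdist x p)].
Proof.
move=> RS RT S0 ST Tx; have [_ _ _ P4] := hP.
have [e eTS xS] := P4 S T x RS RT Tx.
case: eTS => [/= e0|[Te nSe]].
  left; apply: complete_subspace_closed (petal_complete RS S0) _ => //.
  by rewrite xS e0.
right; have [S00 SR _] := proj1 (TENP hR S) RS.
have [T0 TR fT] := proj1 (TENP hR T) RT.
have e0 : 0 < e.
  have := proj1 hR _ (TR _ Te); rewrite /= le_eqVlt => /orP[/eqP e0|//].
  by case: nSe; rewrite -e0.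
suff [p Sp xp] : exists2 p, P S p & mdist x p = e by exists p; rewrite xp.
apply: contrapT => no.
have far p : P S p -> T (mdist x p) /\ e < mdist x p.
  move=> Sp; split; first exact: (petal_valued RT Tx (petal_sub RS RT ST Sp)).
  rewrite lt_neqAle (dist_to_set_le xS Sp) andbT; apply/eqP => xp.
  by apply: no; exists p.
have e1 : e < e + 1 by rewrite ltrDl.
have [p0 Sp0 _] := dist_to_set_lt xS e1.
have [||m [Tm em] mM] := @finite_set_min _ [set s | T s /\ e < s].
- by apply: sub_finite_set (fT e e0) => s [Ts /ltW].
- by exists (mdist x p0); exact: far.
have [p Sp] := dist_to_set_lt xS em.
by rewrite ltNge mM//; exact: far.
Qed.

(** (P4) makes the distance to this petal finite, whereas the distance to the empty set is
    infinite. *)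
Lemma petal0_nonempty : P [set 0] !=set0.
Proof.
have [P1 _ _ P4] := hP.
have [t [Rt t0 _]] := uncountable_other hR 0 ucR.
have Rt2 := TEN_set2 hR Rt.
have t2 : [set 0; t] <> [set 0].
  by apply: (neq_set0 _ t0); right.
have [_ _ _ _ [[x _] _]] := P1 _ Rt2 t2.
have R0 : TEN R [set 0] by apply: (TEN_sub hR Rt2) => // s; left.
have [e _ xe] := P4 _ _ _ R0 Rt2 (set_valP x).
have [|p Pp _] := dist_to_set_lt (r := e + 1) xe; first by rewrite ltrDl.
by exists p.
Qed.

(* As [v 0] lies in a petal avoiding [r], numbering the open balls of [C] along
   [v] gives the number [0] to all points of [C] in petals [P T] with [~ T r];
   by (P4) a dense sequence of the petal of [S `|` [set 0; r]] hits every open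
   [r]-ball of [C]. *)
Definition closed_ball_seq (C : set X) (r : K) (v : nat -> X) : Prop :=
  exists S, [/\ TEN R S /\ ~ S r, P S (v 0%N), C (v 0%N),
    forall n, P (S `|` [set 0; r]) (v n) &
    forall y e, P (S `|` [set 0; r]) y -> 0 < e -> exists n, mdist y (v n) < e].

(** Remove [r] from a set [T] whose petal contains [x]: by [petal_attained], [x] lies in the smaller
    petal or at distance exactly [r] from one of its points. *)
Lemma exists_closed_ball_seq r x : R r -> 0 < r ->
  exists v, closed_ball_seq [set y | mdist x y <= r] r v.
Proof.
move=> Rr r0; have [P1 _ _ _] := hP.
(* The value [t] survives the removal of [r], so [S] is not [[set 0]] and its petal is complete. *)
have [t [Rt t0 tr]] := uncountable_other hR r ucR.
have [T [RT tT Tx]] := petal_cover x (TEN_set2 hR Rt).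
have Tt : T t by apply: tT; right.
pose S := T `\ r.
have S0 : S 0.
  split; first by have [] := proj1 (TENP hR T) RT.
  by move=> /= r00; rewrite r00 ltxx in r0.
have ST : S `<=` T by move=> s [].
have RS : TEN R S by exact: (TEN_sub hR RT).
have Snr : ~ S r by move=> [_]; apply.
have St : S <> [set 0].
  by apply: (neq_set0 _ t0); split=> //; apply/eqP.
have [p Sp xp] : exists2 p, P S p & mdist x p <= r.
  have [Sx|[p [Sp _ [Tp nSp]]]] := petal_attained RS RT St ST Tx.
    by exists x => //; rewrite mdistxx ltW.
  exists p => //; have [->//|pr] := pselect (mdist x p = r).
  by exfalso; apply: nSp.
pose W := S `|` [set 0; r].
have RW : TEN R W by apply: TENU => //; exact: TEN_set2.
have W0 : W <> [set 0].
  by apply: (neq_set0 _ r0); right; right.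
have [_ _ sW _ [neW _]] := P1 _ RW W0.
have [w wd] := dense_seq sW neW.
have SW : S `<=` W by move=> s; left.
exists (fun n => if n is k.+1 then set_val (w k) else p), S; split=> //.
- by case=> [|k]; [exact: (petal_sub RS RW SW)|exact: (set_valP (w k))].
- move=> y e Wy e0; have [i yi] := wd (SigSub (mem_set Wy)) e e0.
  by exists i.+1.
Qed.

(** Apart from the set [[set 0]] in one direction, petals are read off from coordinates: [c_petal]
    and [petal_c] show that [P S] consists of the points whose coordinates are supported in [S]. *)
Lemma petaloid_coordinates : exists c : X -> K -> nat, coordinates R c.
Proof.
have [P1 _ _ _] := hP.
(* Choosing by the closed ball and its radius, and not by a centre, gives all points of the ball the
   same sequence. *)
have /choice[v vP] : forall Cr : set X * K, exists v,
    (exists v, closed_ball_seq Cr.1 Cr.2 v) -> closed_ball_seq Cr.1 Cr.2 v.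
  move=> Cr.
  have [[w wC]|nw] := pselect (exists v, closed_ball_seq Cr.1 Cr.2 v).
    by exists w.
  by have [x _] := petal0_nonempty; exists (fun=> x) => /nw.
pose u r x := v ([set y | mdist x y <= r], r).
have uP r x : R r -> 0 < r ->
    closed_ball_seq [set y | mdist x y <= r] r (u r x).
  by move=> Rr r0; apply: (vP (_, _)); exact: exists_closed_ball_seq.
have petalU S r : TEN R S -> R r -> TEN R (S `|` [set 0; r]).
  by move=> RS Rr; apply: TENU => //; exact: TEN_set2.
have u_cov r x : R r -> 0 < r -> exists i, mdist x (u r x i) < r.
  move=> Rr r0; have [S [[RS _] _ xu Pu ud]] := uP r x Rr r0.
  have [|p Sp xp] := petal_near (petalU _ _ RS Rr) _ r0 (Pu 0%N) xu.
    by right; right.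
  have [n pn] := ud p r Sp r0; exists n.
  exact: ultrametric_lt xp pn.
have [|//||] := @label_family _ R _ um u.
- move=> r x y Rr r0 xy; rewrite /u; congr (v (_, r)).
  apply/seteqP; split=> z /= h; apply: (ultrametric_le um _ h) => //.
  by rewrite metric_sym.
- move=> r x N Rr r0; have [S [[RS _] _ xu Pu _]] := uP r x Rr r0.
  have W0 : S `|` [set 0; r] <> [set 0].
    by apply: (neq_set0 _ r0); right; right.
  have [_ _ _ _ iW] := P1 _ (petalU _ _ RS Rr) W0.
  have [||y yr xy] := injective_equilateral N.+1
    (SigSub (mem_set (Pu 0%N)) : set_type _) iW _ _ r0.
  - by right; left.
  - by right; right.
  have [i iN] := equilateral_avoid um (y := fun i => set_val (y i)) (u r x) yr.
  exists (set_val (y i)) => //.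
  exact: (ultrametric_le um xu (xy i)).
move=> c [c_supp c_lt c_neq c_surj c_zero]; exists c.
(* The distance from [y] to the first term lies in [T] or in a set avoiding [s], so it is below [s];
   a ball hit at index [0] has label [0]. *)
have c_petal T y s : TEN R T -> P T y -> ~ T s -> c y s = 0%N.
  move=> RT Ty nTs; apply: contrapT => cys; have [Rs s0] := c_supp _ _ cys.
  have [S [[RS nSs] Su yu _ _]] := uP s y Rs s0.
  have RTS := TENU hR RT RS.
  have dTS : (T `|` S) (mdist y (u s y 0%N)).
    apply: (petal_valued RTS).
      by apply: (petal_sub RT RTS _ Ty) => z; left.
    by apply: (petal_sub RS RTS _ Su) => z; right.
  have [|j] := c_zero y s 0%N cys; last by rewrite ltn0.
  rewrite lt_neqAle [X in _ && X]yu andbT; apply/eqP => ys.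
  by move: dTS; rewrite ys => -[].
(* Otherwise some [p] in the petal is at a distance outside [S], where the labels of both [x] and
   [p] vanish although they must differ. *)
have petal_c S x : TEN R S -> S <> [set 0] ->
    (forall s, c x s <> 0%N -> S s) -> P S x.
  move=> RS S0 cS; have [T [RT ST Tx]] := petal_cover x RS.
  have [//|[p [Sp xp [Td nSd]]]] := petal_attained RS RT S0 ST Tx.
  exfalso; have Rd : R (mdist x p) by exact: vX.
  apply: (c_neq _ _ Rd xp); rewrite (c_petal S p)//.
  by apply: contrapT => /cS.
apply: coordinates_of_labels => //.
- by move=> x y; apply: c_neq.
- move=> x e e0; have [T [RT _ Tx]] := petal_cover x (TEN_set2 hR (proj2 hR)).
  have [_ _ fT] := proj1 (TENP hR T) RT.
  apply: sub_finite_set (fT e e0) => s [cxs es]; split=> //.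
  by apply: contrapT => nTs; apply: cxs; exact: c_petal nTs.
- have [x Px] := petal0_nonempty; exists x => s; apply: contrapT => cxs.
  have [_ s0] := c_supp _ _ cxs; apply: cxs; apply: c_petal Px _.
    by apply: (TEN_sub hR (TEN_set2 hR (proj2 hR))) => // z; left.
  by move=> /= s00; rewrite s00 ltxx in s0.
- move=> x r n Rr r0.
  have [T [RT _ Tx]] := petal_cover x (TEN_set2 hR (proj2 hR)).
  (* Discarding the positive values below [r] moves [x] by less than [r], by (P4); it leaves a petal
     whose points have zero labels below [r]. *)
  pose T' := [set 0] `|` [set s | T s /\ r <= s].
  have [T0 TR fT] := proj1 (TENP hR T) RT.
  have T'T : T' `<=` T by move=> s [->|[]].
  have RT' : TEN R T' by apply: (TEN_sub hR RT T'T); left.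
  have [q T'q xq] : exists2 q, P T' q & mdist x q < r.
    have [_ _ _ P4] := hP; have [e eT xT'] := P4 _ _ _ RT' RT Tx.
    apply: (dist_to_set_lt xT'); case: eT => [/= ->//|[Te nT'e]].
    by rewrite ltNge; apply/negP => re; apply: nT'e; right.
  (* With [r] added, the petal meets every open [r]-ball of the closed ball, including the one
     labelled [n]. *)
  pose W := T' `|` [set 0; r].
  have RW : TEN R W by exact: petalU.
  have Wr : W r by right; right.
  have Wq : P W q by apply: petal_sub T'q => // s; left.
  have [y' xy' yn] := c_surj x r n Rr r0.
  have y'q : mdist y' q <= r.
    by apply: (ultrametric_le um _ (ltW xq)); rewrite metric_sym.
  have [y Wy y'y] := petal_near RW Wr r0 Wq y'q.
  exists y; split; first exact: ultrametric_le (ltW y'y).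
    by rewrite -(c_lt _ _ _ y'y).
  move=> s sr; apply: contrapT => cys; have [Rs s0] := c_supp _ _ cys.
  apply: cys; apply: (c_petal _ _ _ RW Wy) => -[[s00|[_ rs]]|[s00|sE]].
  + by rewrite s00 ltxx in s0.
  + by rewrite ltNge rs in sr.
  + by rewrite s00 ltxx in s0.
  + by rewrite sE ltxx in sr.
move=> f [fR ff] w wf cw.
have [t [Rt t0 _]] := uncountable_other hR 0 ucR.
(* All [w n] lie in the petal of [S]; the value [t] keeps [S] different from [[set 0]] even when [f]
   vanishes, so this petal is complete. *)
pose S := [set s | f s <> 0%N] `|` [set 0; t].
have RS : TEN R S.
  apply/(TENP hR); split; first by right; left.
    by move=> s [/fR[]//|[->|->]] //; exact: (proj2 hR).
  move=> e e0; apply: (@sub_finite_set _ _ ([set s | f s <> 0%N /\ e <= s] `|`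
    [set 0; t])); first by move=> s [[fs|ts] es]; [left|right].
  by rewrite finite_setU; split => //; exact: ff.
have S0 : S <> [set 0].
  by apply: (neq_set0 _ t0); right; right.
have [|l _ lw] := complete_subspace_cvg (petal_complete RS S0) _ cw.
  by move=> n; apply: petal_c => // s /wf; left.
by exists l.
Qed.

End petals.

Theorem theorem1p2 (K : realType) (R : set K) (X : metricType K)
  (hR : range_set R) (hX : urysohn R X) :
  urysohn R ((X * X)%type : metricType K) /\
  isometric ((X * X)%type : metricType K) X.
Proof.
have [c cX] : exists c : X -> K -> nat, coordinates R c.
  have [h1 h2] := hX; have [cR|ucR] := pselect (countable R).
    exact: separable_coordinates (h1 cR).
  have [um vX [P hP]] := h2 ucR; exact: petaloid_coordinates hP.
have [e eX] := coordinates_prod cX.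
have XX := coordinates_isometric eX cX.
by split=> //; apply: isometric_urysohn (isometric_sym XX) hX.
Qed.
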